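(* Let $A=\bigoplus_{n\in\mathbb{Z}}A_n$ be a $\mathbb{Z}$-graded Noetherian ring such that the integral closure of $A$ in its total ring of fractions is $\mathbb{Z}$-graded. Then: (1) $A$ is seminormal if and only if the localization $A_{\mathfrak{m}}$ is seminormal for every graded maximal ideal $\mathfrak{m}$ of $A$. (2) $A$ is weakly normal if and only if the localization $A_{\mathfrak{m}}$ is weakly normal for every graded maximal ideal $\mathfrak{m}$ of $A$.
   Context: All rings are commutative with unit. For a reduced Noetherian ring $A$ consider the conditions: (i) for any $y,z\in A$ with $y^3=z^2$, there is $x\in A$ with $y=x^2$ and $z=x^3$; (ii) for any $y,z,w\in A$, any nonzero divisor $d\in A$ and any prime integer $p$ with $z^p=yd^p$ and $pz=dw$, there is $x\in A$ with $y=x^p$ and $w=px$. A Noetherian ring is called seminormal if it is reduced and satisfies (i), and weakly normal if it is reduced and satisfies both (i) and (ii). A graded maximal ideal of a $\mathbb{Z}$-graded ring is an ideal that is maximal among the proper homogeneous ideals (such an ideal is prime, but need not be a maximal ideal of the ring). The hypothesis that the integral closure $\overline{A}$ of $A$ in its total ring of fractions is $\mathbb{Z}$-graded means that $\overline{A}$ has a $\mathbb{Z}$-grading extending that of $A$, i.e. $A_n\subseteq \overline{A}_n$ for all $n$. *)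

(* Defs.v *)
From HB Require Import structures.
From mathcomp Require Import all_boot all_order all_algebra.
From mathcomp Require Import boolp.
From mathcomp Require Import ring.

Set Implicit Arguments.
Unset Strict Implicit.
Unset Printing Implicit Defensive.

Import Order.TTheory GRing.Theory Num.Theory.
Local Open Scope ring_scope.
Local Open Scope quotient_scope.

(* Rings are [comPzRingType]s, so that the zero ring is not excluded. Subsets  *)
(* of a ring are boolean predicates; by [boolp] every subset is of this form.  *)

Section Localization.
Variables (R : comPzRingType) (S : mulrClosed R).

Definition fracpair : Type := (R * {s : R | s \in S})%type.
HB.instance Definition _ := Choice.on fracpair.

Implicit Types x y z : fracpair.

Definition equivloc x y : bool :=
  `[< exists2 u, u \in S & u * (x.1 * sval y.2) = u * (y.1 * sval x.2) >].

Lemma equivlocP x y :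
  reflect (exists2 u, u \in S & u * (x.1 * sval y.2) = u * (y.1 * sval x.2))
          (equivloc x y).
Proof. exact: asboolP. Qed.

Lemma equivloc_refl : reflexive equivloc.
Proof. by move=> x; apply/equivlocP; exists 1; rewrite ?rpred1. Qed.

Lemma equivloc_sym : symmetric equivloc.
Proof. by move=> x y; apply/equivlocP/equivlocP => -[u uS e]; exists u. Qed.

Lemma equivloc_trans : transitive equivloc.
Proof.
move=> y x z /equivlocP[u uS eu] /equivlocP[v vS ev]; apply/equivlocP.
exists (u * v * sval y.2); first by rewrite !rpredM ?(svalP y.2).
have -> : u * v * sval y.2 * (x.1 * sval z.2)
  = (u * (x.1 * sval y.2)) * (v * sval z.2) by ring.
have -> : u * v * sval y.2 * (z.1 * sval x.2)
  = (v * (z.1 * sval y.2)) * (u * sval x.2) by ring.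
by rewrite eu -ev; ring.
Qed.

Canonical equivloc_equiv :=
  EquivRel equivloc equivloc_refl equivloc_sym equivloc_trans.

Definition localization := {eq_quot equivloc}.

HB.instance Definition _ : EqQuotient _ equivloc localization :=
  EqQuotient.on localization.
HB.instance Definition _ := Choice.on localization.

Definition locfrac (a : R) (s : {s : R | s \in S}) : localization :=
  \pi_localization ((a, s) : fracpair).

Lemma locfracP a s b t :
  locfrac a s = locfrac b t <->
  exists2 u, u \in S & u * (a * sval t) = u * (b * sval s).
Proof.
split=> [/eqmodP/equivlocP //|h].
by apply/eqmodP/equivlocP.
Qed.

Lemma locfracE (q : localization) :
  q = locfrac (repr q).1 (repr q).2.
Proof. by rewrite /locfrac -surjective_pairing reprK. Qed.

Lemma locfracW (P : localization -> Prop) :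
  (forall a s, P (locfrac a s)) -> forall q, P q.
Proof. by move=> h q; rewrite (locfracE q). Qed.

Definition den1 : {s : R | s \in S} := exist _ 1 (@rpred1 _ S).
Definition denM (s t : {s : R | s \in S}) : {s : R | s \in S} :=
  exist _ (sval s * sval t) (@rpredM _ S _ _ (svalP s) (svalP t)).

Definition addloc (p q : localization) : localization :=
  let x := repr p in let y := repr q in
  locfrac (x.1 * sval y.2 + y.1 * sval x.2) (denM x.2 y.2).
Definition mulloc (p q : localization) : localization :=
  let x := repr p in let y := repr q in
  locfrac (x.1 * y.1) (denM x.2 y.2).
Definition opploc (p : localization) : localization :=
  let x := repr p in locfrac (- x.1) x.2.

Lemma repr_locfrac a s :
  exists2 u, u \in S & u * ((repr (locfrac a s)).1 * sval s)
                       = u * (a * sval (repr (locfrac a s)).2).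
Proof. by apply/locfracP; rewrite -locfracE. Qed.

Lemma addlocE a s b t :
  addloc (locfrac a s) (locfrac b t)
  = locfrac (a * sval t + b * sval s) (denM s t).
Proof.
rewrite /addloc; apply/locfracP => /=.
have [u uS eu] := repr_locfrac a s; have [v vS ev] := repr_locfrac b t.
move: (repr (locfrac a s)) (repr (locfrac b t)) eu ev => x y eu ev.
exists (u * v); first exact: rpredM.
have -> : u * v * ((x.1 * sval y.2 + y.1 * sval x.2) * (sval s * sval t))
  = (u * (x.1 * sval s)) * (v * sval y.2 * sval t)
    + (v * (y.1 * sval t)) * (u * sval x.2 * sval s) by ring.
by rewrite eu ev; ring.
Qed.

Lemma mullocE a s b t :
  mulloc (locfrac a s) (locfrac b t) = locfrac (a * b) (denM s t).
Proof.
rewrite /mulloc; apply/locfracP => /=.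
have [u uS eu] := repr_locfrac a s; have [v vS ev] := repr_locfrac b t.
move: (repr (locfrac a s)) (repr (locfrac b t)) eu ev => x y eu ev.
exists (u * v); first exact: rpredM.
have -> : u * v * (x.1 * y.1 * (sval s * sval t))
  = (u * (x.1 * sval s)) * (v * (y.1 * sval t)) by ring.
by rewrite eu ev; ring.
Qed.

Lemma opplocE a s : opploc (locfrac a s) = locfrac (- a) s.
Proof.
rewrite /opploc; apply/locfracP => /=.
have [u uS eu] := repr_locfrac a s; exists u => //.
by rewrite !mulNr !mulrN eu.
Qed.

Lemma locfrac_eq a s b t : a * sval t = b * sval s -> locfrac a s = locfrac b t.
Proof. by move=> e; apply/locfracP; exists 1; rewrite ?rpred1 ?e. Qed.

Lemma addlocA : associative addloc.
Proof.
elim/locfracW=> a s; elim/locfracW=> b t; elim/locfracW=> c r.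
by rewrite !addlocE; apply: locfrac_eq => /=; ring.
Qed.

Lemma addlocC : commutative addloc.
Proof.
elim/locfracW=> a s; elim/locfracW=> b t.
by rewrite !addlocE; apply: locfrac_eq => /=; ring.
Qed.

Lemma add0loc : left_id (locfrac 0 den1) addloc.
Proof.
by elim/locfracW=> a s; rewrite addlocE; apply: locfrac_eq => /=; ring.
Qed.

Lemma addNloc : left_inverse (locfrac 0 den1) opploc addloc.
Proof.
by elim/locfracW=> a s; rewrite opplocE addlocE; apply: locfrac_eq => /=; ring.
Qed.

HB.instance Definition _ :=
  GRing.isZmodule.Build localization addlocA addlocC add0loc addNloc.

Lemma mullocA : associative mulloc.
Proof.
elim/locfracW=> a s; elim/locfracW=> b t; elim/locfracW=> c r.
by rewrite !mullocE; apply: locfrac_eq => /=; ring.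
Qed.

Lemma mullocC : commutative mulloc.
Proof.
elim/locfracW=> a s; elim/locfracW=> b t.
by rewrite !mullocE; apply: locfrac_eq => /=; ring.
Qed.

Lemma mul1loc : left_id (locfrac 1 den1) mulloc.
Proof.
by elim/locfracW=> a s; rewrite mullocE; apply: locfrac_eq => /=; ring.
Qed.

Lemma mullocDl : left_distributive mulloc addloc.
Proof.
elim/locfracW=> a s; elim/locfracW=> b t; elim/locfracW=> c r.
by rewrite !(addlocE, mullocE); apply: locfrac_eq => /=; ring.
Qed.

HB.instance Definition _ := GRing.Zmodule_isComPzRing.Build localization
  mullocA mullocC mul1loc mullocDl.

Definition toloc (a : R) : localization := locfrac a den1.

Lemma toloc_is_zmod_morphism : zmod_morphism toloc.
Proof.
move=> a b; rewrite [RHS]/GRing.add /= [X in addloc _ X]/GRing.opp /=.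
by rewrite opplocE addlocE; apply: locfrac_eq => /=; ring.
Qed.

Lemma toloc_is_monoid_morphism : monoid_morphism toloc.
Proof.
split=> // a b; rewrite [RHS]/GRing.mul /= mullocE.
by apply: locfrac_eq => /=; ring.
Qed.

HB.instance Definition _ := GRing.isZmodMorphism.Build R localization toloc
  toloc_is_zmod_morphism.
HB.instance Definition _ := GRing.isMonoidMorphism.Build R localization toloc
  toloc_is_monoid_morphism.

End Localization.

Section TotalFractions.
Variable R : comPzRingType.

Definition nonzerodiv : {pred R} := fun d => `[< GRing.lreg d >].

Lemma nonzerodiv_mulr_closed : mulr_closed nonzerodiv.
Proof.
split=> [|x y /asboolP xr /asboolP yr]; apply/asboolP; first exact: lreg1.
exact: lregM.
Qed.

HB.instance Definition _ :=
  GRing.isMulClosed.Build R nonzerodiv nonzerodiv_mulr_closed.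

Definition total_fractions : comPzRingType := localization nonzerodiv.

Definition to_total_fractions (a : R) : total_fractions := toloc nonzerodiv a.

HB.instance Definition _ := GRing.RMorphism.copy to_total_fractions (toloc nonzerodiv).

(* [integralOver] of [mxpoly] is not available over a possibly zero ring;      *)
(* below, [c] lists the lower coefficients of a monic polynomial of degree n.  *)
Definition integral_closure : {pred total_fractions} := fun z =>
  `[< exists (n : nat) (c : 'I_n -> R),
        z ^+ n + \sum_(i < n) to_total_fractions (c i) * z ^+ i = 0 >].

End TotalFractions.

Section Ideals.
Variable R : comPzRingType.

Definition is_ideal (I : {pred R}) : Prop :=
  zmod_closed I /\ forall a, {in I, forall x, a * x \in I}.

Definition noetherian : Prop :=
  forall I : {pred R}, is_ideal I ->
    exists (n : nat) (g : 'I_n -> R),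
      forall x, x \in I <-> exists c : 'I_n -> R, x = \sum_(i < n) c i * g i.

Definition prime_ideal (P : {pred R}) : Prop :=
  [/\ is_ideal P, 1 \notin P &
      forall a b, a * b \in P -> a \in P \/ b \in P].

Definition prime_compl (P : {pred R}) (hP : prime_ideal P) : {pred R} :=
  fun x => x \notin P.

Lemma prime_compl_mulr_closed P (hP : prime_ideal P) :
  mulr_closed (prime_compl hP).
Proof.
have [_ P1 PM] := hP; split=> // a b; rewrite !unfold_in => aP bP.
by apply/negP => /PM[]; apply/negP.
Qed.

HB.instance Definition _ (P : {pred R}) (hP : prime_ideal P) :=
  GRing.isMulClosed.Build R (prime_compl hP) (prime_compl_mulr_closed hP).

Definition localization_at (P : {pred R}) (hP : prime_ideal P) : comPzRingType :=
  localization (prime_compl hP).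

End Ideals.

Section Gradings.
Variable R : comPzRingType.

(* [G] is a Z-grading of the subring [B] of [R]: the [G n] are additive        *)
(* subgroups of [B], [G m * G n] is contained in [G (m + n)], and [B] is the   *)
(* internal direct sum of the [G n].                                           *)
Definition is_grading (B : {pred R}) (G : int -> {pred R}) : Prop :=
  [/\ forall n, zmod_closed (G n) /\ {subset G n <= B},
      forall m n x y, x \in G m -> y \in G n -> x * y \in G (m + n),
      forall x, x \in B -> exists (s : seq int) (c : int -> R),
        (forall n, c n \in G n) /\ x = \sum_(n <- s) c n
    & forall (s : seq int) (c : int -> R), uniq s -> (forall n, c n \in G n) ->
        \sum_(n <- s) c n = 0 -> forall n, n \in s -> c n = 0].

Definition homogeneous_ideal (G : int -> {pred R}) (I : {pred R}) : Prop :=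
  is_ideal I /\
  forall (s : seq int) (c : int -> R), uniq s -> (forall n, c n \in G n) ->
    \sum_(n <- s) c n \in I -> forall n, n \in s -> c n \in I.

Definition graded_maximal (G : int -> {pred R}) (m : {pred R}) : Prop :=
  [/\ homogeneous_ideal G m, 1 \notin m &
      forall I : {pred R}, homogeneous_ideal G I -> 1 \notin I ->
        {subset m <= I} -> {subset I <= m}].

Section GradedMaximalPrime.
Variables (G : int -> {pred R}) (hG : is_grading predT G).

Lemma zmod_closed_add (S : {pred R}) :
  zmod_closed S -> 0 \in S /\ {in S &, forall x y, x + y \in S}.
Proof.
move=> [S0 SB]; split=> // x y xS yS.
have yN : - y \in S by rewrite -sub0r; exact: SB.
by rewrite -[y]opprK; exact: SB.
Qed.

Lemma grading_decomp x : exists (s : seq int) (c : int -> R),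
  [/\ uniq s, forall n, c n \in G n, forall n, n \notin s -> c n = 0
    & x = \sum_(n <- s) c n].
Proof.
have [G0 _ Gd _] := hG; have [//|s [c [cG ->]]] := Gd x.
exists (undup s), (fun n => if n \in s then c n *+ count_mem n s else 0).
have GC n : zmod_closed (G n) by have [] := G0 n.
split=> [|n|n|]; first exact: undup_uniq.
- case: ifP => // _; last by have [] := GC n.
  elim: (count _ _) => [|k IH]; first by rewrite mulr0n; have [] := GC n.
  by rewrite mulrS; apply: (zmod_closed_add (GC n)).2.
- by rewrite mem_undup => /negPf->.
rewrite -big_undup_iterop_count /=; apply: eq_big_seq => n.
by rewrite mem_undup => ->.
Qed.

Lemma max_mem (P : pred int) (s : seq int) : has P s ->
  exists2 p, p \in s /\ P p & forall i, i \in s -> p < i -> ~~ P i.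
Proof.
elim: s => //= a s IH; have [/IH[p [ps Pp] pmax] _|hs] := boolP (has P s).
  have [/andP[pa Pa]|pa] := boolP ((p < a) && P a).
    exists a; [by rewrite mem_head | move=> i].
    rewrite inE => /predU1P[->|/pmax pi ai]; first by rewrite ltxx.
    by apply: pi; exact: lt_trans ai.
  exists p; [by rewrite inE ps orbT | move=> i].
  rewrite inE => /predU1P[->|/pmax//] pi.
  by move: pa; rewrite pi.
rewrite orbF => Pa; exists a; [by rewrite mem_head | move=> i].
rewrite inE => /predU1P[->|si _]; first by rewrite ltxx.
by apply: contraNN hs => Pi; apply/hasP; exists i.
Qed.

Lemma zmod_closed_sum (I : {pred R}) (J : Type) (s : seq J) (Q : pred J)
    (F : J -> R) :
  zmod_closed I -> (forall i, Q i -> F i \in I) -> \sum_(i <- s | Q i) F i \in I.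
Proof.
move=> Iz FI; have [I0 ID] := zmod_closed_add Iz.
by elim/big_ind: _ => // x y xI yI; exact: ID.
Qed.

Lemma graded_maximal_prime (m : {pred R}) :
  graded_maximal G m -> prime_ideal m.
Proof.
move=> [[mI mH] m1 mM]; have [mz mMul] := mI; split=> //.
have hom j b : b \in G j -> b \notin m -> forall x, x * b \in m -> x \in m.
  move=> bG bm; pose J : {pred R} := fun x => x * b \in m.
  have JE x : (x \in J) = (x * b \in m) by [].
  suff JH : homogeneous_ideal G J.
    move=> x xb; apply: (mM J JH) => //; first by rewrite JE mul1r.
    by move=> y ym; rewrite JE mulrC mMul.
  split; first split.
  - split=> [|x y]; rewrite !JE ?mul0r ?mulrBl; first by case: mz.
    by case: mz => _; apply.
  - by move=> a x; rewrite !JE -mulrA; apply: mMul.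
  move=> s c us cG; rewrite JE mulr_suml => sm n ns; rewrite JE.
  have [_ GM _ _] := hG.
  have := mH [seq k + j | k <- s] (fun k => c (k - j) * b).
  have -> : \sum_(k <- [seq k + j | k <- s]) c (k - j) * b
      = \sum_(k <- s) c k * b.
    by rewrite big_map; apply: eq_bigr => k _; rewrite addrK.
  move=> /(_ _ _ sm (n + j)); rewrite addrK; apply.
  - by rewrite map_inj_uniq //; apply: addIr.
  - by move=> k; rewrite -{2}(subrK j k); apply: GM.
  - exact: map_f.
move=> a b abm; apply/orP; apply/negPn/negP; rewrite negb_or => /andP[am bm].
have [sa [ca [ua caG ca0 ea]]] := grading_decomp a.
have [sb [cb [ub cbG cb0 eb]]] := grading_decomp b.
have hasm (s : seq int) (c : int -> R) x : x = \sum_(n <- s) c n -> x \notin m ->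
    has [pred n | c n \notin m] s.
  move=> ->; apply: contraNT; rewrite -all_predC => /allP h.
  rewrite big_seq; apply: zmod_closed_sum => // i si.
  by have /= := h i si; rewrite negbK.
have [p [ps pm] pmax] := max_mem (hasm _ _ _ ea am).
have [q [qs qm] qmax] := max_mem (hasm _ _ _ eb bm).
have camax i : p < i -> ca i \in m.
  have [si|si _] := boolP (i \in sa).
    by move=> pi; apply/negPn; exact: pmax.
  by rewrite ca0 //; case: mz.
have cbmax i : q < i -> cb i \in m.
  have [si|si _] := boolP (i \in sb).
    by move=> qi; apply/negPn; exact: qmax.
  by rewrite cb0 //; case: mz.
pose t := undup [seq i + j | i <- sa, j <- sb].
pose d k := \sum_(i <- sa) ca i * cb (k - i).
have [G0 GM _ _] := hG.
have dG k : d k \in G k.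
  have [Gz _] := G0 k; apply: zmod_closed_sum => // i _.
  by have := GM _ _ _ _ (caG i) (cbG (k - i)); rewrite [i + _]addrC subrK.
have ed : \sum_(k <- t) d k = a * b.
  rewrite /d exchange_big /= ea mulr_suml; apply: eq_big_seq => i isa.
  rewrite -mulr_sumr; congr (_ * _); rewrite eb.
  transitivity (\sum_(k <- t | k - i \in sb) cb (k - i)).
    rewrite [LHS](bigID [pred k | k - i \in sb]) /= [X in _ + X]big1 ?addr0 //.
    by move=> k; apply: cb0.
  transitivity (\sum_(k <- [seq i + j | j <- sb]) cb (k - i)).
    rewrite -big_filter; apply: perm_big; apply: uniq_perm.
    - exact/filter_uniq/undup_uniq.
    - by rewrite map_inj_uniq //; apply: addrI.
    move=> k; rewrite mem_filter mem_undup; apply/andP/mapP.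
      by case=> ksb _; exists (k - i) => //; rewrite addrC subrK.
    case=> j jsb ->; rewrite addrC addKr; split=> //.
    by apply/allpairsP; exists (i, j); rewrite addrC.
  by rewrite big_map; apply: eq_bigr => j _; rewrite addrC addKr.
have pqt : p + q \in t.
  by rewrite mem_undup; apply/allpairsP; exists (p, q).
have dm : d (p + q) \in m.
  by apply: (mH t d) => //; rewrite ?undup_uniq // ed.
suff cm : ca p * cb q \in m by move/negP: pm; apply; apply: hom cm.
have rm : \sum_(i <- rem p sa) ca i * cb (p + q - i) \in m.
  rewrite big_seq; apply: zmod_closed_sum => // i.
  rewrite mem_rem_uniq // !inE => /andP[ip _].
  have [pi|pi|e] := ltgtP p i; last by rewrite e eqxx in ip.
    by rewrite mulrC; apply: mMul; apply: camax.
  by apply: mMul; apply: cbmax; rewrite ltrBrDr addrC ltrD2r.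
have [_ mB] := mz; have := mB _ _ dm rm.
by rewrite /d (big_rem p) //= addrK (addrC p) addrK.
Qed.

End GradedMaximalPrime.
End Gradings.

Section Normality.
Variable R : comPzRingType.

Definition reduced : Prop := forall (x : R) (n : nat), x ^+ n = 0 -> x = 0.

Definition condition_i : Prop :=
  forall y z : R, y ^+ 3 = z ^+ 2 -> exists x, y = x ^+ 2 /\ z = x ^+ 3.

Definition condition_ii : Prop :=
  forall (y z w d : R) (p : nat), GRing.lreg d -> prime p ->
    z ^+ p = y * d ^+ p -> p%:R * z = d * w ->
    exists x, y = x ^+ p /\ w = p%:R * x.

Definition seminormal : Prop := [/\ noetherian R, reduced & condition_i].

Definition weakly_normal : Prop :=
  [/\ noetherian R, reduced, condition_i & condition_ii].

End Normality.

(* Main.v *)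
(* Both conditions ask for an element [q] of the total fraction ring [K] to    *)
(* lie in [A]: [q = z / (y + e)] for (i), where [y e = 0] and [y + e] is a     *)
(* nonzerodivisor, and [q = z / d] for (ii); in both cases [q] is integral,    *)
(* hence a sum of components q_n. The local hypothesis gives [u q \in A] with  *)
(* [u] outside a graded maximal ideal [m], and [u] can be replaced by a        *)
(* homogeneous [f] outside [m] such that [f q_n \in A] for all [n]. Hence the  *)
(* homogeneous ideal of all [a] with [a q_n \in A] for all [n] lies in no      *)
(* graded maximal ideal, so contains 1. Conversely, both conditions pass to    *)
(* any localization by clearing denominators; for (ii) a nonzerodivisor [d] of *)
(* the localization must first be lifted to a nonzerodivisor of [A], of the    *)
(* form [d + e] with [d e = 0].                                                *)

Require Import Defs.
From HB Require Import structures.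
From mathcomp Require Import all_boot all_order all_algebra.
From mathcomp Require Import boolp.
From mathcomp Require Import ring zify.

Import Order.TTheory GRing.Theory.
Local Open Scope ring_scope.

Set Implicit Arguments.
Unset Strict Implicit.

(** Both conditions pass to the localization at any multiplicative set ([seminormal_localization],
    [weakly_normal_localization]). The converse rests on a local-global principle,
    [mem_of_graded_localizations]: for a homogeneous submodule [N] of a graded extension, membership
    in [N] can be tested at the graded maximal ideals. The multipliers outside these ideals need not
    be homogeneous; [homogeneous_annihilator] replaces them by homogeneous ones. With [N = 0] the
    principle gives reducedness. With [N] the image of [A] in its total fractions it gives
    [integral_descent], where the grading of the integral closure supplies the components of an
    integral fraction. A root for (i) or (ii) exists as such a fraction, and it agrees, up to a
    multiplier, with each local root because the total fraction ring is reduced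
    ([local_cuspidal_root], [local_prime_root]). *)

Section CommutativeRings.

(** * Noetherian and reduced rings *)

Variable R : comPzRingType.

Lemma ideal0 (I : {pred R}) : is_ideal I -> 0 \in I.
Proof. by case=> -[]. Qed.

(** Otherwise choice builds a strictly increasing chain; the finitely many generators of its union
    already lie in one stage. The index type lets the maximum range over elements
    ([regular_complement]) as well as over ideals ([graded_maximal_above]). *)
Lemma noetherian_maximal (T : Type) (P : T -> Prop) (F : T -> {pred R}) (t0 : T) :
  noetherian R -> (forall t, P t -> is_ideal (F t)) -> P t0 ->
  exists2 t, P t & forall t', P t' -> {subset F t <= F t'} -> {subset F t' <= F t}.
Proof.
move=> noeth idF Pt0; apply: contrapT => nomax.
have /choice[next nextP] (t : {t | P t}) : exists t' : {t | P t},
    {subset F (sval t) <= F (sval t')} /\ ~ {subset F (sval t') <= F (sval t)}.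
  apply: contrapT => none; apply: nomax; exists (sval t); first exact: svalP.
  move=> t' Pt' tt'; apply: contrapT => t't.
  by apply: none; exists (exist _ t' Pt').
pose c k := F (sval (iter k next (exist _ t0 Pt0))).
have cid k : is_ideal (c k) by apply: idF; apply: svalP.
have cS k : {subset c k <= c k.+1} by have [] := nextP (iter k next (exist _ t0 Pt0)).
have cD i j : {subset c i <= c (j + i)%N}.
  by elim: j => // j IH x /IH xj; exact: cS.
have cle i j : (i <= j)%N -> {subset c i <= c j} by move=> /subnK <-; exact: cD.
pose U : {pred R} := fun x => `[< exists k, x \in c k >].
have UP x : x \in U <-> exists k, x \in c k by split=> /asboolP.
have Uid : is_ideal U.
  split; first split.
  - by apply/UP; exists 0%N; apply: ideal0.
  - move=> x y /UP[i xi] /UP[j yj]; apply/UP; exists (maxn i j).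
    have [[_ cB] _] := cid (maxn i j).
    by apply: cB; [apply: cle xi | apply: cle yj]; rewrite ?leq_maxl ?leq_maxr.
  - move=> a x /UP[k xk]; apply/UP; exists k.
    by have [_ cM] := cid k; exact: cM.
have [n [g gP]] := noeth U Uid.
have gU i : exists k, g i \in c k.
  apply/UP/gP; exists (fun j => (j == i)%:R).
  rewrite (bigD1 i) //= eqxx mul1r big1 ?addr0 // => j /negPf ->.
  by rewrite mul0r.
have [k kP] := choice gU.
pose N := \max_(i < n) k i.
have [_] := nextP (iter N next (exist _ t0 Pt0)); apply => x xN.
have /gP[a ->] : x \in U by apply/UP; exists N.+1.
have [cz cM] := cid N.
apply: zmod_closed_sum; [exact: cz|].
by move=> i _; apply: cM; apply: cle (kP i); exact: leq_bigmax.
Qed.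

(* Among the [e] with [d * e = 0], choose one whose annihilator is minimal,    *)
(* that is, whose double annihilator is maximal.                               *)
Lemma regular_complement (d : R) :
  noetherian R -> reduced R -> exists2 e, d * e = 0 & GRing.lreg (d + e).
Proof.
move=> noeth red.
have sqr0 (x : R) : x * x = 0 -> x = 0 by move=> xx; apply: (red _ 2); rewrite expr2.
pose F (e : R) : {pred R} := fun b => `[< forall a, a * e = 0 -> a * b = 0 >].
have FP e b : b \in F e <-> forall a, a * e = 0 -> a * b = 0 by split=> /asboolP.
have Fid e : is_ideal (F e).
  split; first split.
  - by apply/FP => a _; rewrite mulr0.
  - move=> x y /FP Fx /FP Fy; apply/FP => a ae.
    by rewrite mulrBr Fx // Fy // subrr.
  - by move=> b x /FP Fx; apply/FP => a ae; rewrite mulrCA Fx // mulr0.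
have [//||e de emax] := @noetherian_maximal R (fun e => d * e = 0) F 0 noeth.
  by rewrite mulr0.
exists e => //.
suff reg t : (d + e) * t = 0 -> t = 0.
  by move=> x y /= /eqP; rewrite -subr_eq0 -mulrBr => /eqP/reg/eqP; rewrite subr_eq0 => /eqP.
move=> det.
have dt : d * t = 0.
  apply: sqr0; have -> : d * t * (d * t) = d * t * ((d + e) * t) - (d * e) * (t * t) by ring.
  by rewrite det de !(mulr0, mul0r) subrr.
have et : e * t = 0 by move: det; rewrite mulrDl dt add0r.
(* [e + t] is again a candidate, with [F e] inside [F (e + t)], so maximality applies. As [t] kills
   [e], it then kills [e + t], whence [t * t = 0]. *)
have /FP/(_ t) : e + t \in F e.
  apply: (emax (e + t)); first by rewrite mulrDr de dt addr0.
    move=> b /FP Fb; apply/FP => s set0; apply: Fb; apply: sqr0.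
    have -> : s * e * (s * e) = s * e * (s * (e + t)) - s * s * (e * t) by ring.
    by rewrite set0 et !mulr0 subrr.
  by apply/FP => a; rewrite mulrDr mulrC.
by rewrite mulrC => /(_ et); rewrite mulrDr mulrC et add0r => /sqr0.
Qed.

(** Expanding [((a - b) + b) ^+ p], every middle term contains both [p] and [a - b]. In a reduced
    ring an element is thus determined by its [p]-th power and its [p]-fold multiple. *)
Lemma expr_prime_sub (p : nat) (a b : R) :
  prime p -> p%:R * (a - b) = 0 -> a ^+ p = b ^+ p -> (a - b) ^+ p = 0.
Proof.
move=> pp; set r := a - b => pr; rewrite -(subrK b a) -/r exprDn.
case: p pp pr => // p pp pr.
rewrite big_ord_recl big_ord_recr /= subn0 subnn !expr0 mulr1 mul1r bin0 binn !mulr1n.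
rewrite big1 ?add0r; first by move/eqP; rewrite -subr_eq0 addrK => /eqP.
move=> i _; rewrite /bump /= add1n subSS.
have /dvdnP[k ->] : (p.+1 %| 'C(p.+1, i.+1))%N by apply: prime_dvd_bin; rewrite //= ltnS ltn_ord.
rewrite mulnC mulrnA -[_ *+ p.+1]mulr_natl.
have -> : (p - i)%N = (p - i.+1).+1 by rewrite subnSK.
by rewrite exprS !mulrA pr !mul0r mul0rn.
Qed.

End CommutativeRings.

(** * Passage of the conditions to a localization *)

Section Localization.
Variables (R : comPzRingType) (S : mulrClosed R).
Local Notation "a %:L" := (toloc S a) (at level 2, format "a %:L").

Lemma toloc_eqP a b : a%:L = b%:L <-> exists2 u, u \in S & u * a = u * b.
Proof.
split=> [/locfracP[u uS]|[u uS e]]; first by rewrite /= !mulr1 => e; exists u.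
by apply/locfracP; exists u; rewrite //= !mulr1.
Qed.

Lemma toloc_eq0P a : a%:L = 0 <-> exists2 u, u \in S & u * a = 0.
Proof.
rewrite -(rmorph0 (toloc S)); split=> [/toloc_eqP|] [u uS]; rewrite ?mulr0 => e.
  by exists u.
by apply/toloc_eqP; exists u; rewrite ?mulr0.
Qed.

Lemma toloc_frac a s : s \in S -> exists q, q * s%:L = a%:L.
Proof.
move=> sS; exists (locfrac a (exist _ s sS)).
by rewrite [LHS]/GRing.mul /= mullocE; apply: locfrac_eq => /=; ring.
Qed.

Lemma toloc_den (q : localization S) : exists a, exists2 s, s \in S & q * s%:L = a%:L.
Proof.
elim/locfracW: q => a [s sS]; exists a, s => //.
by rewrite [LHS]/GRing.mul /= mullocE; apply: locfrac_eq => /=; ring.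
Qed.

Lemma toloc_unit s : s \in S -> exists q, s%:L * q = 1.
Proof. by move=> /(toloc_frac 1)[q e]; exists q; rewrite mulrC e rmorph1. Qed.

Lemma toloc_reg s : s \in S -> GRing.lreg s%:L.
Proof.
move=> /toloc_unit[q qs] x y /= /(congr1 ( *%R q)).
by rewrite !mulrA (mulrC q) qs !mul1r.
Qed.

Lemma noetherian_localization : noetherian R -> noetherian (localization S).
Proof.
move=> noeth I Iid; have [[I0 IB] IM] := Iid.
pose J : {pred R} := fun a => a%:L \in I.
have JE a : (a \in J) = (a%:L \in I) by [].
have [|n [g gP]] := noeth J.
  split; first split.
  - by rewrite JE rmorph0.
  - by move=> a b; rewrite !JE rmorphB; exact: IB.
  - by move=> a b; rewrite !JE rmorphM; exact: IM.
exists n, (fun i => (g i)%:L) => q; split=> [qI|[c ->]].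
  have [a [s sS e]] := toloc_den q; have [r sr] := toloc_unit sS.
  have /gP[c ac] : a \in J by rewrite JE -e mulrC IM.
  exists (fun i => r * (c i)%:L).
  rewrite -[LHS]mulr1 -sr mulrA e ac rmorph_sum /= mulr_suml.
  by apply: eq_bigr => i _; rewrite rmorphM mulrC mulrA.
apply: (@zmod_closed_sum _ I); first by case: Iid.
move=> i _; apply: IM; rewrite -JE; apply/gP.
exists (fun j => (j == i)%:R); rewrite (bigD1 i) //= eqxx mul1r big1 ?addr0 //.
by move=> j /negPf ->; rewrite mul0r.
Qed.

Lemma reduced_localization : reduced R -> reduced (localization S).
Proof.
move=> red q n qn; have [a [s sS e]] := toloc_den q.
have /toloc_eq0P[u uS ua] : (a ^+ n)%:L = 0.
  by rewrite rmorphXn /= -e exprMn qn mul0r.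
apply: (toloc_reg sS); rewrite [LHS]mulrC e mulr0; apply/toloc_eq0P; exists u => //.
(* The exponent [n.+1] guarantees a factor [u] even when [n = 0]. *)
apply: (red _ n.+1); rewrite exprS exprMn.
have -> : u * a * (u ^+ n * a ^+ n) = u * a ^+ n * (a * u ^+ n) by ring.
by rewrite ua mul0r.
Qed.

Lemma condition_i_localization : condition_i R -> condition_i (localization S).
Proof.
move=> Ri q r qr.
have [a [s sS qs]] := toloc_den q; have [b [t tS rt]] := toloc_den r.
have /toloc_eqP[u uS e] : (a ^+ 3 * t ^+ 2)%:L = (b ^+ 2 * s ^+ 3)%:L.
  by rewrite !(rmorphM, rmorphXn) /= -qs -rt !exprMn qr; ring.
(* The two elements of [R] below represent [c ^+ 2 * q] and [c ^+ 3 * r]; the spare powers of [u]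
   turn [e] into an equation in [R]. The root is then divided by [c]. *)
pose c := s * t * u; have cS : c \in S by rewrite !rpredM.
have [x [ax bx]] : exists x, a * s * t ^+ 2 * u ^+ 2 = x ^+ 2 /\
                             b * s ^+ 3 * t ^+ 2 * u ^+ 3 = x ^+ 3.
  apply: Ri.
  have -> : (a * s * t ^+ 2 * u ^+ 2) ^+ 3
    = u * (a ^+ 3 * t ^+ 2) * (s ^+ 3 * t ^+ 4 * u ^+ 5) by ring.
  by rewrite e; ring.
have [y yc] := toloc_frac x cS; exists y; split.
  apply: (@lregX _ _ 2 (toloc_reg cS)) => /=.
  rewrite [RHS]mulrC -exprMn yc -[RHS]rmorphXn -ax /c !(rmorphM, rmorphXn) /= -qs; ring.
apply: (@lregX _ _ 3 (toloc_reg cS)) => /=.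
rewrite [RHS]mulrC -exprMn yc -[RHS]rmorphXn -bx /c !(rmorphM, rmorphXn) /= -rt; ring.
Qed.

(** The correction [e] with [d * e = 0] dies in the localization, where [d] is cancellable. *)
Lemma toloc_lreg_lift d : noetherian R -> reduced R -> GRing.lreg d%:L ->
  exists2 d', GRing.lreg d' & d'%:L = d%:L.
Proof.
move=> noeth red dreg; have [e de reg] := regular_complement d noeth red.
exists (d + e) => //; rewrite rmorphD /=; suff -> : e%:L = 0 by rewrite addr0.
by apply: dreg; rewrite /= mulr0 -rmorphM de rmorph0.
Qed.

Lemma condition_ii_localization :
  noetherian R -> reduced R -> condition_ii R -> condition_ii (localization S).
Proof.
move=> noeth red Rii y z w d p dreg pp zyd pzdw.
have [a [s sS ys]] := toloc_den y; have [b [t tS zt]] := toloc_den z.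
have [f [r rS wr]] := toloc_den w; have [g [v vS dv]] := toloc_den d.
have [|h hreg hg] := @toloc_lreg_lift g noeth red.
  by rewrite -dv; apply: lregM => //; exact: toloc_reg.
have [n pE] : exists n, p = n.+1 by case: p pp {zyd pzdw} => // n; exists n.
(* Multiplying [y], [z], [w], [d] by [k^p], [k v], [k], [v] clears denominators *)
(* and keeps both equations.                                                   *)
pose k := s * t * r; have kS : k \in S by rewrite !rpredM.
have [Y Yk] : exists Y, y * k%:L ^+ p = Y%:L.
  exists (a * (t * r) * k ^+ n).
  by rewrite pE exprS /k !(rmorphM, rmorphXn) /= -ys; ring.
have [Z Zk] : exists Z, z * k%:L * v%:L = Z%:L.
  by exists (b * (s * r * v)); rewrite /k !rmorphM /= -zt; ring.
have [W Wk] : exists W, w * k%:L = W%:L.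
  by exists (f * (s * t)); rewrite /k !rmorphM /= -wr; ring.
have /toloc_eqP[u1 u1S e1] : (Z ^+ p)%:L = (Y * h ^+ p)%:L.
  by rewrite rmorphM !rmorphXn /= -Zk -Yk hg -dv !exprMn zyd; ring.
have /toloc_eqP[u2 u2S e2] : (p%:R * Z)%:L = (h * W)%:L.
  rewrite !rmorphM rmorph_nat /= -Zk -Wk hg -dv.
  by rewrite !mulrA pzdw; ring.
(* [e1] and [e2] hold in [R] only up to [u1] and [u2]; scaling [Y] by [u ^+ p] and [Z], [W] by [u]
   absorbs both. *)
pose u := u1 * u2; have uS : u \in S by rewrite rpredM.
have [x [Yx Wx]] : exists x, Y * u ^+ p = x ^+ p /\ W * u = p%:R * x.
  apply: (Rii _ (Z * u) _ h) => //.
    rewrite exprMn /u pE !exprS; rewrite pE !exprS in e1.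
    transitivity (u1 * (Z * Z ^+ n) * (u2 * u ^+ n)); first by rewrite /u; ring.
    by rewrite e1 /u; ring.
  transitivity (u1 * (u2 * (p%:R * Z))); first by rewrite /u; ring.
  by rewrite e2 /u; ring.
clearbody k u; have kuS : k * u \in S by rewrite rpredM.
have [X Xk] := toloc_frac x kuS; exists X; split.
  apply: (@lregX _ _ p (toloc_reg kuS)) => /=.
  rewrite [RHS]mulrC -exprMn Xk -[RHS]rmorphXn -Yx !(rmorphM, rmorphXn) /= -Yk !exprMn; ring.
apply: (toloc_reg kuS) => /=.
rewrite mulrCA [_ * X]mulrC Xk -(rmorph_nat (toloc S)) -rmorphM -Wx !rmorphM /= -Wk; ring.
Qed.

Lemma seminormal_localization : seminormal R -> seminormal (localization S).
Proof.
case=> noeth red Ri; split; first exact: noetherian_localization.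
  exact: reduced_localization.
exact: condition_i_localization.
Qed.

Lemma weakly_normal_localization : weakly_normal R -> weakly_normal (localization S).
Proof.
case=> noeth red Ri Rii; split; first exact: noetherian_localization.
- exact: reduced_localization.
- exact: condition_i_localization.
- exact: condition_ii_localization.
Qed.

End Localization.

(** * The local-global principle for homogeneous submodules *)

Lemma sum_by_degree (V : nmodType) (J : eqType) (r : seq J) (deg : J -> int) (x : J -> V) :
  \sum_(j <- r) x j = \sum_(k <- undup (map deg r)) \sum_(j <- r | deg j == k) x j.
Proof.
rewrite (exchange_big_dep xpredT) //=; apply: eq_big_seq => j jr.
rewrite big_mkcond (bigD1_seq (deg j)) ?undup_uniq ?mem_undup ?map_f //= eqxx.
by rewrite big1 ?addr0 // => k /negPf; rewrite eq_sym => ->.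
Qed.

Section GradedRings.
Variables (A K : comPzRingType) (phi : {rmorphism A -> K}).
Variables (G : int -> {pred A}) (B : {pred K}) (H : int -> {pred K}).
Hypotheses (hG : is_grading predT G) (hH : is_grading B H).
Hypothesis phiGH : forall n a, a \in G n -> phi a \in H n.

Lemma homogeneous_sum (J : Type) (r : seq J) (Q : pred J) (x : J -> K) k :
  (forall j, Q j -> x j \in H k) -> \sum_(j <- r | Q j) x j \in H k.
Proof. by move=> xH; apply: zmod_closed_sum => //; have [/(_ k)[]] := hH. Qed.

Lemma homogeneous_scale k l a x : a \in G k -> x \in H l -> phi a * x \in H (k + l).
Proof. by move=> /phiGH aH xH; have [_ HM _ _] := hH; exact: HM. Qed.

Lemma grading_components x : x \in B -> exists (s : seq int) (c : int -> K),
  [/\ uniq s, forall n, c n \in H n & x = \sum_(n <- s) c n].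
Proof.
have [_ _ Hd _] := hH => /Hd[s [c [cH ->]]].
exists (undup (map id s)), (fun k => \sum_(n <- s | n == k) c n).
split; [exact: undup_uniq | | exact: (sum_by_degree s id)].
by move=> k; apply: homogeneous_sum => j /eqP <-.
Qed.

Variable N : {pred K}.
Hypotheses (Nz : zmod_closed N) (Nphi : forall a x, x \in N -> phi a * x \in N).
Hypothesis Nhom : forall (s : seq int) (c : int -> K), uniq s ->
  (forall n, c n \in H n) -> \sum_(n <- s) c n \in N -> forall n, n \in s -> c n \in N.

(** Extends [Nhom] to sums in which degrees may repeat, as in an expanded product. *)
Lemma degree_part_mem (J : eqType) (r : seq J) (deg : J -> int) (x : J -> K) k :
  (forall j, x j \in H (deg j)) -> \sum_(j <- r) x j \in N ->
  \sum_(j <- r | deg j == k) x j \in N.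
Proof.
move=> xH; rewrite (sum_by_degree r deg) => xN.
have [kr|kr] := boolP (k \in undup (map deg r)).
  apply: (Nhom (undup_uniq _) _ xN kr).
  by move=> n; apply: homogeneous_sum => j /eqP <-.
rewrite big_seq_cond big_pred0 ?(zmod_closed_add Nz).1 // => j.
by apply: contraNF kr => /andP[jr /eqP <-]; rewrite mem_undup map_f.
Qed.

Lemma max_degree (s : seq int) : s != [::] ->
  exists2 p, p \in s & forall i, i \in s -> (i <= p)%R.
Proof.
move=> s0; have [|p [ps _] pm] := @max_mem predT s; first by case: s s0.
by exists p => // i si; rewrite leNgt; apply/negP => /(pm i si).
Qed.

(* The degree [p + q] part of a product is the product of the leading terms.   *)
Lemma leading_product_mem (s t : seq int) (c : int -> K) (v : int -> A) k l p q :
  uniq s -> uniq t -> (forall n, c n \in H (n + k)) -> (forall i, v i \in G (i + l)) ->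
  p \in s -> (forall n, n \in s -> n <= p) -> q \in t -> (forall i, i \in t -> i <= q) ->
  phi (\sum_(i <- t) v i) * (\sum_(n <- s) c n) \in N -> phi (v q) * c p \in N.
Proof.
move=> us ut cH vG ps pmax qt qmax.
pose r := [seq (i, n) | i <- t, n <- s].
pose x (j : int * int) := phi (v j.1) * c j.2.
pose deg (j : int * int) := (j.1 + l) + (j.2 + k).
have -> : phi (\sum_(i <- t) v i) * (\sum_(n <- s) c n) = \sum_(j <- r) x j.
  rewrite big_allpairs rmorph_sum mulr_suml; apply: eq_bigr => i _.
  by rewrite mulr_sumr.
move=> /(@degree_part_mem _ _ deg) -/(_ (deg (q, p))).
rewrite big_mkcond (bigD1_seq (q, p)) ?allpairs_f ?allpairs_uniq //=; last by case=> ? ? [].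
rewrite eqxx big1_seq ?addr0.
  by apply=> j; apply: homogeneous_scale.
move=> [i n] /andP[/= ne /allpairsP[[i' n'] /= [it ns [ei en]]]].
rewrite -{}ei -{}en in it ns; case: ifP => // /eqP; rewrite /deg /= => e.
case/negP: ne; have := qmax i it; have := pmax n ns; rewrite xpair_eqE.
by move=> *; apply/andP; split; apply/eqP; lia.
Qed.

Section Prime.
Variable P : {pred A}.
Hypothesis primeP : prime_ideal P.

(* With [q] and [p] the top degrees of [v] and [c], multiplying [c] by [v q]   *)
(* removes [c p] modulo [N]. By induction on the number of components some     *)
(* homogeneous [f] outside [P] satisfies [f v_q c_n \in N] for all [n]; then   *)
(* either [f v_q] is as required, or [v q \in P] can be dropped from [f v].    *)
Lemma homogeneous_annihilator (s t : seq int) (c : int -> K) (v : int -> A) k l :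
  uniq s -> uniq t -> (forall n, c n \in H (n + k)) -> (forall i, v i \in G (i + l)) ->
  (exists2 i, i \in t & v i \notin P) ->
  phi (\sum_(i <- t) v i) * (\sum_(n <- s) c n) \in N ->
  exists j f, [/\ f \in G j, f \notin P & forall n, n \in s -> phi f * c n \in N].
Proof.
have [_ _ PM] := primeP.
have [_ GM _ _] := hG.
have [N0 ND] := zmod_closed_add Nz.
have [_ NB] := Nz.
move: {2}_.+1 (ltnSn (size s + size t)) => m.
(* The shifts [k] and [l] vary in the induction: multiplying a family by a homogeneous element
   changes its shift and leaves its index set alone. *)
elim: m s t c v k l => // m IH s t c v k l szm us ut cH vG [i0 i0t vi0] uxN.
have [s0|s0] := eqVneq s [::].
  by exists (i0 + l), (v i0); split; rewrite ?s0.
have t0 : t != [::] by case: t i0t {ut szm uxN}.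
have [p ps pmax] := max_degree s0; have [q qt qmax] := max_degree t0.
have qpN := leading_product_mem us ut cH vG ps pmax qt qmax uxN.
have szs : (size s = (size (rem p s)).+1)%N by rewrite size_rem // prednK //; case: (s) s0.
have szt : (size t = (size (rem q t)).+1)%N by rewrite size_rem // prednK //; case: (t) t0.
have [|||||||j [f [fG fP fN]]] := IH (rem p s) t (fun n => phi (v q) * c n) v (k + (q + l)) l.
- by move: szm; rewrite szs addSn ltnS.
- exact: rem_uniq.
- exact: ut.
- by move=> n; rewrite addrA addrC; apply: homogeneous_scale.
- exact: vG.
- by exists i0.
- rewrite -mulr_sumr mulrCA.
  have -> : \sum_(n <- rem p s) c n = \sum_(n <- s) c n - c p.
    by rewrite (big_rem p ps) /= addrC addrK.
  have -> : phi (v q) * (phi (\sum_(i <- t) v i) * (\sum_(n <- s) c n - c p))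
    = phi (v q) * (phi (\sum_(i <- t) v i) * \sum_(n <- s) c n)
      - phi (\sum_(i <- t) v i) * (phi (v q) * c p) by ring.
  by apply: NB; apply: Nphi.
have {}fN n : n \in s -> phi (f * v q) * c n \in N.
  move=> ns; rewrite rmorphM -mulrA; have [->|np] := eqVneq n p; first exact: Nphi.
  by apply: fN; rewrite mem_rem_uniq // inE np.
have fM a : a \notin P -> f * a \notin P by move=> aP; apply/negP => /PM[]; apply/negP.
have [vqP|vqP] := boolP (v q \in P); last first.
  by exists (j + (q + l)), (f * v q); split=> //; [exact: GM | exact: fM].
apply: (IH s (rem q t) c (fun i => f * v i) k (j + l)) => //.
- by move: szm; rewrite szt addnS ltnS.
- exact: rem_uniq.
- by move=> i; rewrite addrCA; exact: GM.
- exists i0; last exact: fM.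
  by rewrite mem_rem_uniq // inE i0t andbT; apply: contraNneq vi0 => ->.
(* [f * v q] sends every [c n] into [N], hence also their sum; subtracting this removes the term
   [v q]. *)
rewrite -mulr_sumr.
have -> : \sum_(i <- rem q t) v i = \sum_(i <- t) v i - v q.
  by rewrite (big_rem q qt) /= addrC addrK.
rewrite mulrBr rmorphB mulrBl rmorphM -mulrA; apply: NB; first exact: Nphi.
by rewrite mulr_sumr big_seq; apply: zmod_closed_sum.
Qed.

End Prime.

(** The Noetherian hypothesis takes the place of Zorn's lemma. *)
Lemma graded_maximal_above (J : {pred A}) : noetherian A ->
  homogeneous_ideal G J -> 1 \notin J -> exists2 m, graded_maximal G m & {subset J <= m}.
Proof.
move=> noeth Jid J1.
have [||m [[mid m1] Jm] mmax] := @noetherian_maximal A _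
    (fun I => (homogeneous_ideal G I /\ 1 \notin I) /\ {subset J <= I}) id J noeth.
- by move=> I [[[]]].
- by split; first split.
exists m => //; split=> // I Iid I1 mI; apply: mmax => //; split=> // a /Jm; exact: mI.
Qed.

Lemma mem_of_graded_localizations x : noetherian A -> x \in B ->
  (forall m, graded_maximal G m -> exists2 u, u \notin m & phi u * x \in N) -> x \in N.
Proof.
move=> noeth /grading_components[s [c [us cH ->]]] loc.
pose J : {pred A} := fun a => `[< forall n, n \in s -> phi a * c n \in N >].
have JP a : a \in J <-> forall n, n \in s -> phi a * c n \in N by split=> /asboolP.
have [N0 NB] := Nz.
suff /JP J1 : 1 \in J.
  rewrite big_seq; apply: zmod_closed_sum => // n ns.
  by rewrite -[c n]mul1r -(rmorph1 phi); exact: J1.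
apply/negPn/negP => J1; have [||m mmax Jm] := @graded_maximal_above J noeth => //.
  split; first split.
  - split; first by apply/JP => n _; rewrite rmorph0 mul0r.
    by move=> a b /JP aJ /JP bJ; apply/JP => n ns; rewrite rmorphB mulrBl NB ?aJ ?bJ.
  - by move=> a b /JP bJ; apply/JP => n ns; rewrite rmorphM -mulrA; apply/Nphi/bJ.
  (* [J] is homogeneous: for fixed [n], the part of degree [i + n] of the product with [c n] is the
     single term [phi (v i) * c n]. *)
  move=> t v ut vG /JP tJ i it; apply/JP => n ns.
  have := tJ n ns; rewrite rmorph_sum mulr_suml => /(@degree_part_mem _ _ (+%R^~ n)).
  move=> /(_ (i + n)); rewrite big_mkcond (bigD1_seq i) //= eqxx big1 ?addr0.
    by apply=> j; exact: homogeneous_scale.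
  by move=> j /negPf ji; rewrite (inj_eq (addIr n)) ji.
have [u um uxN] := loc m mmax.
have primem := graded_maximal_prime hG mmax.
have [t [v [ut vG _ uE]]] := grading_decomp hG u.
have [i it vi] : exists2 i, i \in t & v i \notin m.
  apply: contrapT => vm; case/negP: um; rewrite uE big_seq.
  apply: zmod_closed_sum => [|i it]; first by case: primem => -[].
  by apply: contrapT => /negP vi; apply: vm; exists i.
have [||||j [f [fG fm fN]]] := homogeneous_annihilator (k := 0) (l := 0) primem us ut (c := c) (v := v).
- by move=> n; rewrite addr0.
- by move=> n; rewrite addr0.
- by exists i.
- by rewrite -uE.
by case/negP: fm; apply: Jm; apply/JP.
Qed.

End GradedRings.

(** * Comparison of a global root with a local one *)

Section DescentFromLocalization.
Variables (A K : comPzRingType) (phi : {rmorphism A -> K}) (S : mulrClosed A).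
Hypothesis redK : reduced K.

(** For the local root [b / t], the elements [t q] and [b] of [K] have equal squares and equal cubes
    up to a factor [u] in [S]. Hence the cube of [u t q - u b] vanishes, and [K] is reduced. *)
Lemma local_cuspidal_root y z q : condition_i (localization S) -> y ^+ 3 = z ^+ 2 ->
  q ^+ 2 = phi y -> q ^+ 3 = phi z ->
  exists2 u, u \in S & exists a, phi u * q = phi a.
Proof.
move=> Si yz q2 q3.
have [|x [yx zx]] := Si (toloc S y) (toloc S z); first by rewrite -!rmorphXn yz.
have [b [t tS xt]] := toloc_den x.
have /toloc_eqP[u1 u1S e1] : toloc S (y * t ^+ 2) = toloc S (b ^+ 2).
  by rewrite rmorphM !rmorphXn /= -xt yx exprMn.
have /toloc_eqP[u2 u2S e2] : toloc S (z * t ^+ 3) = toloc S (b ^+ 3).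
  by rewrite rmorphM !rmorphXn /= -xt zx exprMn.
have uS : u1 * u2 \in S by rewrite rpredM.
have {}e1 : u1 * u2 * (y * t ^+ 2) = u1 * u2 * b ^+ 2 by rewrite mulrAC e1 mulrAC.
have {}e2 : u1 * u2 * (z * t ^+ 3) = u1 * u2 * b ^+ 3 by rewrite -!mulrA e2.
move: (u1 * u2) uS e1 e2 => u uS e1 e2.
exists (u * t); first by rewrite rpredM.
exists (u * b); apply/eqP; rewrite -subr_eq0; apply/eqP; apply: (redK (n := 3)).
have {}e1 := congr1 phi e1; have {}e2 := congr1 phi e2.
rewrite !(rmorphM, rmorphXn) /= -q2 in e1; rewrite !(rmorphM, rmorphXn) /= -q3 in e2.
rewrite !rmorphM.
have -> : (phi u * phi t * q - phi u * phi b) ^+ 3 =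
  phi u ^+ 2 * (phi u * (q ^+ 3 * phi t ^+ 3) - phi u * phi b ^+ 3
    + 3%:R * (q * phi t * (phi u * phi b ^+ 2 - phi u * (q ^+ 2 * phi t ^+ 2))
              - phi b * (phi u * (q ^+ 2 * phi t ^+ 2) - phi u * phi b ^+ 2)
              + (phi u * (q ^+ 3 * phi t ^+ 3) - phi u * phi b ^+ 3))) by ring.
by rewrite e2 e1 !subrr !(mulr0, subr0, addr0).
Qed.

(** Same comparison: [u t q] and [u b] have equal [p]-th powers and [p]-fold multiples, so
    [expr_prime_sub] applies. *)
Lemma local_prime_root y z w d p q : condition_ii (localization S) ->
  GRing.lreg d -> prime p -> z ^+ p = y * d ^+ p -> p%:R * z = d * w ->
  q ^+ p = phi y -> p%:R * q = phi w ->
  exists2 u, u \in S & exists a, phi u * q = phi a.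
Proof.
move=> Sii dreg pp zyd pzdw qp pq.
have [||||x [yx wx]] := Sii (toloc S y) (toloc S z) (toloc S w) (toloc S d) p.
- have reg0 a : toloc S d * a = 0 -> a = 0.
    have [b [s sS as_]] := toloc_den a => da.
    have /toloc_eq0P[u uS udb] : toloc S (d * b) = 0 by rewrite rmorphM /= -as_ mulrA da mul0r.
    apply: (toloc_reg sS); rewrite /= mulr0 mulrC as_; apply/toloc_eq0P; exists u => //.
    by apply: dreg; rewrite /= mulr0 mulrCA.
  move=> a b /eqP; rewrite -subr_eq0 -mulrBr => /eqP/reg0/eqP.
  by rewrite subr_eq0 => /eqP.
- exact: pp.
- by rewrite -!rmorphXn -rmorphM zyd.
- by rewrite -(rmorph_nat (toloc S)) -!rmorphM pzdw.
have [b [t tS xt]] := toloc_den x.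
have /toloc_eqP[u1 u1S e1] : toloc S (y * t ^+ p) = toloc S (b ^+ p).
  by rewrite rmorphM !rmorphXn /= -xt yx exprMn.
have /toloc_eqP[u2 u2S e2] : toloc S (w * t) = toloc S (p%:R * b).
  by rewrite !rmorphM rmorph_nat /= -xt wx mulrA.
have uS : u1 * u2 \in S by rewrite rpredM.
have {}e1 : u1 * u2 * (y * t ^+ p) = u1 * u2 * b ^+ p by rewrite mulrAC e1 mulrAC.
have {}e2 : u1 * u2 * (w * t) = u1 * u2 * (p%:R * b) by rewrite -!mulrA e2.
move: (u1 * u2) uS e1 e2 => u uS e1 e2.
exists (u * t); first by rewrite rpredM.
exists (u * b); apply/eqP; rewrite -subr_eq0; apply/eqP; apply: (redK (n := p)).
apply: expr_prime_sub => //.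
  transitivity (phi (u * (w * t)) - phi (u * (p%:R * b))); last by rewrite e2 subrr.
  by rewrite !rmorphM rmorph_nat -pq; ring.
have [n pE] : exists n, p = n.+1 by case: (p) pp => // n; exists n.
transitivity (phi (u * (y * t ^+ p)) * phi u ^+ n).
  by rewrite pE !(rmorphM, rmorphXn) -pE -qp !exprMn pE !exprS; ring.
by rewrite e1 !(rmorphM, rmorphXn) !exprMn pE !exprS; ring.
Qed.

End DescentFromLocalization.

(** * The total ring of fractions *)

Section TotalFractions.
Variable A : comPzRingType.
Local Notation K := (total_fractions A).
Local Notation phi := (@to_total_fractions A).

Lemma to_total_fractions_inj : injective phi.
Proof. by move=> a b /toloc_eqP[u /asboolP ureg]; apply: ureg. Qed.

Lemma total_fraction z d : GRing.lreg d -> exists q : K, q * phi d = phi z.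
Proof. by move=> dreg; apply: toloc_frac; apply/asboolP. Qed.

Lemma to_total_fractions_reg d : GRing.lreg d -> GRing.lreg (phi d).
Proof. by move=> dreg; apply: toloc_reg; apply/asboolP. Qed.

Lemma integral_closure_root n (q : K) a : q ^+ n.+1 = phi a -> q \in @integral_closure A.
Proof.
move=> qn; apply/asboolP; exists n.+1, (fun i => if i == ord0 then - a else 0).
rewrite big_ord_recl big1 => [|i _] /=; last by rewrite rmorph0 mul0r.
by rewrite rmorphN expr0 mulr1 addr0 qn subrr.
Qed.

Definition total_image : {pred K} := fun q => `[< exists a, q = phi a >].

Lemma total_imageP q : q \in total_image <-> exists a, q = phi a.
Proof. by split=> /asboolP. Qed.

Lemma total_image_zmod : zmod_closed total_image.
Proof.
split; first by apply/total_imageP; exists 0; rewrite rmorph0.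
move=> _ _ /total_imageP[a ->] /total_imageP[b ->]; apply/total_imageP.
by exists (a - b); rewrite rmorphB.
Qed.

Lemma total_image_scale a q : q \in total_image -> phi a * q \in total_image.
Proof. by move=> /total_imageP[b ->]; apply/total_imageP; exists (a * b); rewrite rmorphM. Qed.

(** If the sum is [phi a], the images of the components of [a] give a second decomposition, and [H]
    makes the two agree. *)
Lemma total_image_homogeneous (G : int -> {pred A}) (H : int -> {pred K}) :
  is_grading predT G -> is_grading (@integral_closure A) H ->
  (forall n a, a \in G n -> phi a \in H n) ->
  forall (s : seq int) (c : int -> K), uniq s -> (forall n, c n \in H n) ->
  \sum_(n <- s) c n \in total_image -> forall n, n \in s -> c n \in total_image.
Proof.
move=> hG hH GH s c us cH /total_imageP[a ca] n ns.
have [t [b [ut bG b0 ab]]] := grading_decomp hG a.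
have [H0 _ _ Hind] := hH.
(* [c] is arbitrary outside [s]; truncating it allows both decompositions to be summed over
   [s ++ t]. *)
pose c' k := if k \in s then c k else 0.
have c'H k : c' k \in H k by rewrite /c'; case: ifP => // _; case: (H0 k) => -[].
have extend (r : seq int) (x : int -> K) : uniq r -> {subset r <= s ++ t} ->
    (forall k, k \notin r -> x k = 0) ->
    \sum_(k <- r) x k = \sum_(k <- undup (s ++ t)) x k.
  move=> ur rst x0; rewrite [RHS](bigID [in r]) /= [X in _ + X]big1 // addr0.
  rewrite -[RHS]big_filter; apply: perm_big; apply: uniq_perm => //.
    exact/filter_uniq/undup_uniq.
  move=> k; rewrite mem_filter mem_undup.
  by apply/idP/andP => [kr|[]//]; split=> //; apply: rst.
have := Hind (undup (s ++ t)) (fun k => c' k - phi (b k)) (undup_uniq _).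
move=> /(_ _ _ n); rewrite mem_undup mem_cat ns /c' ns => e.
apply/total_imageP; exists (b n); apply/eqP; rewrite -subr_eq0; apply/eqP; apply: e => //.
  by move=> k; have [[_ HB] _] := H0 k; apply: HB; [exact: c'H | exact: GH].
rewrite sumrB -(extend s c') // -?(extend t (fun k => phi (b k))) //.
- have -> : \sum_(k <- s) c' k = \sum_(k <- s) c k by apply: eq_big_seq => k; rewrite /c' => ->.
  by rewrite ca ab rmorph_sum subrr.
- by move=> k kt; rewrite mem_cat kt orbT.
- by move=> k /b0 ->; rewrite rmorph0.
- by move=> k ks; rewrite mem_cat ks.
- by move=> k /negPf; rewrite /c' => ->.
Qed.

(** The root should be [z / y], but [y] may be a zero divisor. Adding [e] with [y * e = 0] makes the
    denominator regular, and [z * e = 0] by reducedness, so [e] does not disturb the equations. *)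
Lemma total_cuspidal_root y z : noetherian A -> reduced A -> y ^+ 3 = z ^+ 2 ->
  exists q : K, q ^+ 2 = phi y /\ q ^+ 3 = phi z.
Proof.
move=> noeth red yz.
have [e ye dreg] := regular_complement y noeth red.
have ze : z * e = 0.
  apply: (red _ 2); rewrite exprMn -yz.
  have -> : y ^+ 3 * e ^+ 2 = y * e * (y ^+ 2 * e) by ring.
  by rewrite ye mul0r.
have [q qd] := total_fraction z dreg.
have kreg := to_total_fractions_reg dreg.
have q2 : q ^+ 2 = phi y.
  apply: (lregX (n := 2) kreg) => /=; rewrite mulrC -exprMn qd -!rmorphXn -rmorphM -yz.
  congr phi; have -> : (y + e) ^+ 2 * y = y ^+ 3 + y * e * (2%:R * y + e) by ring.
  by rewrite ye mul0r addr0.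
exists q; split=> //; apply: kreg => /=.
by rewrite exprSr q2 mulrCA [_ * q]mulrC qd -!rmorphM mulrDl [e * z]mulrC ze addr0.
Qed.

End TotalFractions.

(** * Descent from the graded maximal ideals *)

Section Descent.
Variables (A : comPzRingType) (G : int -> {pred A}).
Hypotheses (hG : is_grading predT G) (noeth : noetherian A).

(** The local-global principle for [K = A] and [N = 0], applied to a nilpotent [x]. *)
Lemma reduced_descent :
  (forall m (hm : graded_maximal G m), reduced (localization_at (graded_maximal_prime hG hm))) ->
  reduced A.
Proof.
move=> loc x n xn.
apply/eqP; apply: (@mem_of_graded_localizations A A idfun G predT G hG hG _ (pred1 0)) => //.
- by split=> [|a b /eqP -> /eqP ->]; rewrite ?inE ?subr0.
- by move=> a b /eqP ->; rewrite inE mulr0.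
- move=> s c us cG /eqP c0 k ks; apply/eqP.
  by have [_ _ _ ind] := hG; exact: ind c0 k ks.
move=> m hm; have /(_ (toloc _ x) n) := loc m hm.
rewrite -rmorphXn xn rmorph0 => /(_ erefl)/toloc_eq0P[u um ux].
by exists u => //; rewrite inE ux.
Qed.

Variable H : int -> {pred total_fractions A}.
Hypotheses (hH : is_grading (@integral_closure A) H).
Hypothesis GH : forall n a, a \in G n -> to_total_fractions a \in H n.

Lemma integral_descent q : q \in @integral_closure A ->
  (forall m, graded_maximal G m -> exists2 u, u \notin m &
     exists a, to_total_fractions u * q = to_total_fractions a) ->
  exists a, q = to_total_fractions a.
Proof.
move=> qint loc; apply/total_imageP.
apply: (mem_of_graded_localizations (phi := @to_total_fractions A) hG hH GH
  (total_image_zmod A) _ _ noeth qint).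
- by move=> a x; apply: total_image_scale.
- by move=> s c us cH cN n; apply: (total_image_homogeneous hG hH GH us cH cN).
by move=> m /loc[u um ua]; exists u => //; apply/total_imageP.
Qed.

Hypothesis red : reduced A.

Lemma condition_i_descent :
  (forall m (hm : graded_maximal G m), condition_i (localization_at (graded_maximal_prime hG hm))) ->
  condition_i A.
Proof.
move=> loc y z yz; have [q [q2 q3]] := total_cuspidal_root noeth red yz.
have [|m hm|x qx] := @integral_descent q; first exact: integral_closure_root q2.
  exact: (local_cuspidal_root (reduced_localization red) (loc m hm) yz q2 q3).
by exists x; split; apply: to_total_fractions_inj; rewrite rmorphXn /= -qx.
Qed.

Lemma condition_ii_descent :
  (forall m (hm : graded_maximal G m), condition_ii (localization_at (graded_maximal_prime hG hm))) ->
  condition_ii A.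
Proof.
move=> loc y z w d p dreg pp zyd pzdw; have [q qd] := total_fraction z dreg.
have kreg := to_total_fractions_reg dreg.
(* Cancelling [d ^+ p] here, and [d] below, turns the two hypotheses on [z] into equations for
   [q = z / d]. *)
have qp : q ^+ p = to_total_fractions y.
  apply: (lregX (n := p) kreg) => /=.
  by rewrite mulrC -exprMn qd -!rmorphXn -rmorphM zyd mulrC.
have pq : p%:R * q = to_total_fractions w.
  apply: kreg => /=.
  by rewrite mulrCA [_ * q]mulrC qd -(rmorph_nat (@to_total_fractions A)) -!rmorphM pzdw.
have [|m hm|x qx] := @integral_descent q.
- by case: p {zyd pzdw pq} pp qp => // p _; exact: integral_closure_root.
- exact: (local_prime_root (reduced_localization red) (loc m hm) dreg pp zyd pzdw qp pq).
exists x; split; apply: to_total_fractions_inj; first by rewrite rmorphXn /= -qx.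
by rewrite rmorphM rmorph_nat /= -qx.
Qed.

End Descent.

Unset Implicit Arguments.
Set Strict Implicit.

Theorem theorem3p6 (A : comPzRingType) (G : int -> {pred A})
    (hG : is_grading predT G) (hA : noetherian A)
    (H : int -> {pred total_fractions A})
    (hH : is_grading (@integral_closure A) H)
    (hGH : forall (n : int) (a : A), a \in G n -> to_total_fractions a \in H n) :
  (seminormal A <->
    forall (m : {pred A}) (hm : graded_maximal G m),
      seminormal (localization_at (graded_maximal_prime hG hm))) /\
  (weakly_normal A <->
    forall (m : {pred A}) (hm : graded_maximal G m),
      weakly_normal (localization_at (graded_maximal_prime hG hm))).
Proof.
split; split.
- by move=> sn m hm; apply: seminormal_localization.
- move=> loc.
  have red : reduced A by apply: (@reduced_descent A G hG hA) => m hm; have [] := loc m hm.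
  split=> //; apply: (@condition_i_descent A G hG hA H hH hGH red) => m hm.
  by have [] := loc m hm.
- by move=> wn m hm; apply: weakly_normal_localization.
move=> loc.
have red : reduced A by apply: (@reduced_descent A G hG hA) => m hm; have [] := loc m hm.
split=> //.
  by apply: (@condition_i_descent A G hG hA H hH hGH red) => m hm; have [] := loc m hm.
by apply: (@condition_ii_descent A G hG hA H hH hGH red) => m hm; have [] := loc m hm.
Qed.
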